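(* Let $\ell_0:\mathbb{R}^d\to\mathbb{R}$ be twice continuously differentiable and let $O\in\mathbb{R}^{d\times k}$ satisfy $O^TO=I_k$. Suppose $\ell_0$ has the $O$-mirror symmetry, i.e. $\ell_0(w)=\ell_0((I-2OO^T)w)$ for all $w\in\mathbb{R}^d$. For $\gamma\ge 0$ let $\ell_\gamma(w)=\ell_0(w)+\gamma\|w\|^2$. Then: 1. For any $\gamma$, if $O^Tw=0$ then $O^T\nabla_w\ell_\gamma(w)=0$. 2. If $OO^Tw=0$, then the Hessian $\nabla_w^2\ell_0(w)$ maps $\ker(O^T)$ into $\ker(O^T)$ and $\operatorname{im}(OO^T)=\ker(O^T)^\perp$ into itself; consequently there is an orthonormal basis of eigenvectors of $\nabla_w^2\ell_0(w)$ a subset of which spans $\ker(O^T)$ and the rest of which spans $\operatorname{im}(OO^T)$. 3. If $O^Tw\neq 0$, there exists $\gamma_0$ such that for all $\gamma>\gamma_0$, $\ell_\gamma((I-OO^T)w)<\ell_\gamma(w)$. 4. Assume in addition that the smallest eigenvalue of $\nabla_w^2\ell_0(w)$ is bounded below by a constant $\lambda_{\min}\in\mathbb{R}$ (possibly negative) uniformly in $w$. Then there exists $\gamma_1$ such that for all $\gamma>\gamma_1$, every minimizer $w$ of $\ell_\gamma$ satisfies $O^Tw=0$.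
   Context: $\ell_0$ plays the role of a per-sample (data-dependent) loss with the data point suppressed; $\gamma$ is the weight decay strength. The matrix $OO^T$ is an orthogonal projection and $I-2OO^T$ is the reflection through the subspace $\ker(O^T)$. *)

(* Defs.v *)
From mathcomp Require Import all_boot all_order all_algebra.
From mathcomp Require Import all_classical all_reals all_analysis.
Import GRing.Theory Num.Theory numFieldNormedType.Exports.
Local Open Scope ring_scope.

Set Implicit Arguments.
Unset Strict Implicit.
Unset Printing Implicit Defensive.

Definition basis_vec (R : realType) (d : nat) (i : 'I_d) : 'cV[R]_d :=
  delta_mx i ord0.

Definition pderiv (R : realType) (d : nat) (i : 'I_d)
  (f : 'cV[R]_d -> R) : 'cV[R]_d -> R :=
  fun x => derive f x (basis_vec R i).

Definition grad (R : realType) (d : nat) (f : 'cV[R]_d -> R) (x : 'cV[R]_d)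
  : 'cV[R]_d := \col_i pderiv i f x.

Definition hessian (R : realType) (d : nat) (f : 'cV[R]_d -> R)
  (x : 'cV[R]_d) : 'M[R]_d := \matrix_(i, j) pderiv j (pderiv i f) x.

Definition C2 (R : realType) (d : nat) (f : 'cV[R]_d -> R) : Prop :=
  (forall x : 'cV[R]_d, {for x, continuous f}) /\
  forall i : 'I_d,
    (forall x, derivable f x (basis_vec R i)) /\
    (forall x : 'cV[R]_d, {for x, continuous (pderiv i f)}) /\
    forall j : 'I_d,
      (forall x, derivable (pderiv i f) x (basis_vec R j)) /\
      (forall x : 'cV[R]_d, {for x, continuous (pderiv j (pderiv i f))}).

Definition sqnorm (R : realType) (d : nat) (w : 'cV[R]_d) : R :=
  \sum_i (w i ord0) ^+ 2.

Definition ell (R : realType) (d : nat) (l0 : 'cV[R]_d -> R) (gamma : R)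
  (w : 'cV[R]_d) : R := l0 w + gamma * sqnorm w.

(* Main.v *)
(** Let [Q = O O^T] and [A = I - 2 Q], an orthogonal involution. Differentiating
    [l0 = l0 o A] once and twice gives [grad l0 w = A (grad l0 (A w))] and
    [H w = A (H (A w)) A]. At a point with [O^T w = 0], which [A] fixes, the
    gradient is therefore killed by [O^T] and the Hessian commutes with [Q];
    being symmetric, it is diagonalized together with [Q]. Replacing [w] by
    [(I - Q) w] lowers [|w|^2] by [|O^T w|^2], so a large [gamma] dominates any
    increase of [l0]. Under the spectral bound that increase is at most
    [|lmin| |O^T w|^2], because the derivative of [l0] along the segment from
    [(I - Q) w] to [w] starts at [0].

    As [C2] only speaks of partial derivatives, the linearity of [v |-> D_v f]
    and the symmetry of the Hessian are derived from their continuity. *)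
Require Import Defs.
From mathcomp Require Import all_boot all_order all_algebra.
From mathcomp Require Import all_classical all_reals all_analysis.
From mathcomp Require Import complex polyrcf ring lra.
Import Order.TTheory GRing.Theory Num.Theory numFieldNormedType.Exports.
Local Open Scope ring_scope.

Set Implicit Arguments.
Unset Strict Implicit.
Unset Printing Implicit Defensive.

(** * Euclidean inner product of column vectors *)

Lemma dotcE (R : pzSemiRingType) (n : nat) (u v : 'cV[R]_n) :
  (u^T *m v) 0 0 = \sum_i u i 0 * v i 0.
Proof. by rewrite mxE; apply: eq_bigr => i _; rewrite mxE. Qed.

Lemma dotcC (R : comPzRingType) (n : nat) (u v : 'cV[R]_n) :
  (u^T *m v) 0 0 = (v^T *m u) 0 0.
Proof. by rewrite !dotcE; apply: eq_bigr => i _; rewrite mulrC. Qed.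

Lemma dotc_ge0 (R : realDomainType) (n : nat) (u : 'cV[R]_n) :
  0 <= (u^T *m u) 0 0.
Proof. by rewrite dotcE; apply: sumr_ge0 => i _; rewrite -expr2 sqr_ge0. Qed.

Lemma dotc_eq0 (R : realDomainType) (n : nat) (u : 'cV[R]_n) :
  ((u^T *m u) 0 0 == 0) = (u == 0).
Proof.
apply/idP/eqP => [|->]; last by rewrite mulmx0 mxE.
rewrite dotcE psumr_eq0 => [/allP u0|i _]; last by rewrite -expr2 sqr_ge0.
apply/colP => i; apply/eqP; rewrite mxE -sqrf_eq0 expr2.
by have := u0 i; rewrite mem_index_enum; apply.
Qed.

Lemma dotc_inj (R : comPzRingType) (n : nat) (a b : 'cV[R]_n) :
  (forall u : 'cV[R]_n, (u^T *m a) 0 0 = (u^T *m b) 0 0) -> a = b.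
Proof.
move=> ab; apply/colP => i; have := ab (delta_mx i 0).
by rewrite trmx_delta -!rowE !mxE.
Qed.

(** * Spectral theorem for real symmetric matrices *)

(** Over the algebraically closed [R[i]] there is a row eigenvector [v], with eigenvalue [a].
    Computing [v H v^*] from either side gives [a] and its conjugate times [v v^*], which is
    nonzero; hence [a] is real, and being a root of the characteristic polynomial descends to
    [R]. *)
Lemma symmetric_eigenvalue (R : rcfType) (n : nat) (H : 'M[R]_n.+1) :
  H^T = H -> exists a, eigenvalue H a.
Proof.
move=> Hs; pose f := real_complex R.
have [a /eigenvalueP[v vA v0]] := eigenvalue_closed (map_mx f H) isT.
pose cj : {rmorphism R[i] -> R[i]} := Num.conj.
have HA : map_mx cj (map_mx f H) = map_mx f H.
  by apply/matrixP => i j; rewrite !mxE; exact: (conjc_real (H i j)).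
have s0 : (v *m (map_mx cj v)^T) 0 0 != 0.
  have -> : (v *m (map_mx cj v)^T) 0 0 = \sum_i `|v 0 i| ^+ 2.
    by rewrite mxE; apply: eq_bigr => i _; rewrite !mxE normCK.
  apply: contra_neq v0 => /eqP.
  rewrite psumr_eq0 => [/allP z|i _]; last by rewrite exprn_ge0.
  apply/rowP => i; apply/eqP; rewrite mxE -normr_eq0 -sqrf_eq0.
  by have := z i; rewrite mem_index_enum; apply.
have aR : cj a = a.
  apply: (mulIf s0).
  have e1 : (v *m map_mx f H *m (map_mx cj v)^T) 0 0 =
            a * (v *m (map_mx cj v)^T) 0 0 by rewrite vA -scalemxAl mxE.
  rewrite -e1 -mulmxA.
  have -> : map_mx f H *m (map_mx cj v)^T = cj a *: (map_mx cj v)^T.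
    rewrite -[LHS]trmxK trmx_mul trmxK [(map_mx f H)^T]map_trmx Hs -{1}HA.
    by rewrite -map_mxM vA map_mxZ linearZ.
  by rewrite -scalemxAr [RHS]mxE.
have [r ar] : exists r, a = f r.
  case: a aR {vA} => x y aR; exists x.
  have [/eqP] : Complex x (- y) = Complex x y := aR.
  by rewrite eqNr => /eqP ->.
exists r; move: vA; rewrite eigenvalue_root_char -(fmorph_root f) map_char_poly.
rewrite ar => vA; rewrite -eigenvalue_root_char; apply/eigenvalueP.
by exists v.
Qed.

Lemma symmetric_eigenvector (R : rcfType) (n : nat) (H : 'M[R]_n.+1) :
  H^T = H -> exists (a : R) (u : 'cV[R]_n.+1), u^T *m u = 1 /\ H *m u = a *: u.
Proof.
move=> Hs; have [a /eigenvalueP[v vH v0]] := symmetric_eigenvalue Hs.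
pose s := (v *m v^T) 0 0.
have s0 : 0 < s.
  by rewrite lt0r /s -{1 3}[v]trmxK dotc_eq0 dotc_ge0 andbT trmx_eq0.
exists a, ((Num.sqrt s)^-1 *: v^T); split.
  rewrite [LHS]mx11_scalar [(_ *: _)^T]linearZ/= -scalemxAl -scalemxAr trmxK.
  rewrite mxE [X in _ * X]mxE -/s mulrA -invfM -expr2 sqr_sqrtr ?ltW//.
  by rewrite mulVf// gt_eqF.
rewrite -scalemxAr -[in LHS]Hs -trmx_mul vH linearZ/=.
by rewrite !scalerA mulrC.
Qed.

(** The reflection along [u - e] exchanges two unit vectors. The case [u = e] is separate because
    the reflection divides by [|u - e|^2]. *)
Lemma householder (R : realFieldType) (n : nat) (e u : 'cV[R]_n) :
  e^T *m e = 1 -> u^T *m u = 1 ->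
  exists U : 'M[R]_n, [/\ U^T = U, U *m U = 1%:M & U *m e = u].
Proof.
move=> ee uu; have [->|ue] := eqVneq u e.
  by exists 1%:M; rewrite trmx1 !mul1mx.
pose w := u - e; pose s := (w^T *m w) 0 0.
have s0 : s != 0 by rewrite dotc_eq0 subr_eq0.
pose p := (u^T *m e) 0 0.
have sE : s = 2 - 2 * p.
  rewrite /s /w [(_ - _)^T]linearB/= mulmxBl !mulmxBr uu ee.
  rewrite [u^T *m e]mx11_scalar [e^T *m u]mx11_scalar (dotcC e u) -/p.
  by rewrite !mxE eqxx !mulr1n; ring.
(* [w^T e = p - 1 = - s / 2], so the reflection adds exactly [w] to [e]. *)
have we : w^T *m e = (- (s / 2))%:M.
  rewrite [LHS]mx11_scalar /w [(_ - _)^T]linearB/= mulmxBl ee.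
  rewrite [u^T *m e]mx11_scalar -/p !mxE eqxx !mulr1n sE.
  by congr (_%:M); field.
exists (1%:M - (2 / s) *: (w *m w^T)); split.
- by rewrite linearB linearZ/= trmx1 trmx_mul trmxK.
- rewrite mulmxBl mul1mx mulmxBr mulmx1 -scalemxAr -scalemxAl scalerA.
  rewrite -mulmxA (mulmxA w^T) [w^T *m w]mx11_scalar -/s mul_scalar_mx.
  rewrite -scalemxAr scalerA -addrA -opprD addrA -scalerDl -scalerBl.
  have -> : 2 / s + 2 / s - 2 / s * (2 / s) * s = 0 by field.
  by rewrite scale0r subr0.
- rewrite mulmxBl mul1mx -scalemxAl -mulmxA we mul_mx_scalar scalerA.
  have -> : 2 / s * - (s / 2) = -1 by field.
  by rewrite scaleN1r opprK addrC subrK.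
Qed.

(** Induction by deflation: conjugating [H] by a reflection that sends the first basis vector to a
    unit eigenvector splits off a 1 x 1 block and leaves a smaller symmetric matrix. *)
Lemma symmetric_spectral (R : rcfType) (n : nat) (H : 'M[R]_n) :
  H^T = H -> exists (P : 'M[R]_n) (D : 'rV[R]_n),
    P^T *m P = 1%:M /\ H *m P = P *m diag_mx D.
Proof.
elim: n H => [|n IHn] H Hs.
  by exists 1%:M, 0; split; apply/matrixP => -[].
have [a [u [uu Hu]]] := symmetric_eigenvector Hs.
pose e : 'cV[R]_(1 + n) := delta_mx 0 0.
have ee : e^T *m e = 1.
  by rewrite /e trmx_delta mul_delta_mx [LHS]mx11_scalar mxE eqxx.
have [U [Us UU Ue]] := householder ee uu.
have eE : e = col_mx 1%:M 0.
  apply/colP => i; rewrite !mxE; case: splitP => j ij;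
    by rewrite !mxE -val_eqE /= ij ?ord1.
pose B : 'M[R]_(1 + n) := U *m H *m U.
have Bs : B^T = B by rewrite /B !trmx_mul Us Hs mulmxA.
have Be : B *m e = a *: e.
  by rewrite /B -[LHS]mulmxA Ue -mulmxA Hu -scalemxAr -Ue mulmxA UU mul1mx.
have HB : H = U *m B *m U by rewrite /B !mulmxA UU mul1mx -mulmxA UU mulmx1.
clearbody B.
(* [B e = a e] determines the first column of [B]; symmetry then clears the rest of the first
   row. *)
have BE : B = block_mx a%:M 0 0 (drsubmx B).
  have : col_mx (ulsubmx B) (dlsubmx B) = col_mx a%:M 0.
    move: Be; rewrite -[X in X *m _]submxK eE mul_block_col !mulmx0 !mulmx1.
    by rewrite !addr0 scale_col_mx scaler0 scalemx1.
  case/eq_col_mx => ul dl; rewrite -[LHS]submxK ul dl.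
  by have := trmx_dlsub B; rewrite Bs dl trmx0 => <-.
have [P [D [PP DP]]] : exists (P : 'M[R]_n) (D : 'rV[R]_n),
    P^T *m P = 1%:M /\ drsubmx B *m P = P *m diag_mx D.
  by apply: IHn; rewrite trmx_drsub Bs.
pose X : 'M[R]_(1 + n) := block_mx 1%:M 0 0 P.
have XX : X^T *m X = 1%:M.
  rewrite tr_block_mx mulmx_block !trmx0 trmx1.
  by rewrite !(mulmx0, mul0mx, mulmx1, addr0, add0r) PP -scalar_mx_block.
have BX : B *m X = X *m diag_mx (row_mx a%:M D).
  have -> : diag_mx (row_mx a%:M D) = block_mx (a%:M : 'M[R]_1) 0 0 (diag_mx D).
    by rewrite diag_mx_row; congr block_mx; apply/matrixP => i j;
      rewrite !ord1 !mxE.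
  rewrite BE !mulmx_block.
  by rewrite !(mulmx0, mul0mx, mulmx1, mul1mx, addr0, add0r) DP.
exists (U *m X), (row_mx a%:M D); split.
  by rewrite trmx_mul Us -mulmxA (mulmxA U) UU mul1mx.
by rewrite HB -!mulmxA (mulmxA U U) UU mul1mx BX.
Qed.

(** * Joint diagonalization with a projection, and the Rayleigh bound *)

(** [eigenvalue] refers to row eigenvectors; by symmetry, transposing a column eigenvector gives
    one. *)
Lemma symmetric_eigenvalueP (R : fieldType) (n : nat) (H : 'M[R]_n) (a : R)
    (x : 'cV[R]_n) :
  H^T = H -> x != 0 -> H *m x = a *: x -> eigenvalue H a.
Proof.
move=> Hs x0 Hx; apply/eigenvalueP; exists x^T; last by rewrite trmx_eq0.
by rewrite -[in LHS]Hs -trmx_mul Hx linearZ.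
Qed.

Lemma col_eigen (R : comPzRingType) (n : nat) (H P : 'M[R]_n) (D : 'rV[R]_n) :
  H *m P = P *m diag_mx D <-> forall j, H *m col j P = D 0 j *: col j P.
Proof.
split=> [HP j|HP].
  rewrite !colE mulmxA HP -colE -colE; apply/colP => i.
  by rewrite mul_mx_diag !mxE mulrC.
apply/matrixP => i j; rewrite mul_mx_diag [RHS]mxE mulrC.
by have /colP/(_ i) := HP j; rewrite {1}colE mulmxA -colE !mxE.
Qed.

Lemma orthogonal_col_neq0 (R : nzRingType) (n : nat) (P : 'M[R]_n) (j : 'I_n) :
  P^T *m P = 1%:M -> col j P != 0.
Proof.
move=> PP; apply/eqP => P0; have /matrixP/(_ j j) := PP.
have -> : (P^T *m P) j j = ((col j P)^T *m col j P) 0 0.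
  by rewrite !mxE; apply: eq_bigr => i _; rewrite !mxE.
by rewrite P0 mulmx0 !mxE eqxx => /esym/eqP; rewrite oner_eq0.
Qed.

(* For c larger than the spread of the spectrum of H, no eigenvector of
   H + c Q has nonzero components in both ker Q and im Q, so the spectral
   theorem applied to H + c Q diagonalizes H and Q at once. *)
Lemma symmetric_projection_spectral (R : rcfType) (n : nat) (H Q : 'M[R]_n) :
  H^T = H -> Q^T = Q -> Q *m Q = Q -> H *m Q = Q *m H ->
  exists (P : 'M[R]_n) (D : 'rV[R]_n),
    [/\ P^T *m P = 1%:M, H *m P = P *m diag_mx D &
        forall j, Q *m col j P = 0 \/ Q *m col j P = col j P].
Proof.
move=> Hs Qs QQ HQ; pose b := cauchy_bound (char_poly H).
have bP a (x : 'cV[R]_n) : x != 0 -> H *m x = a *: x -> `|a| < b.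
  move=> x0 Hx; apply: cauchy_boundP; first exact/monic_neq0/char_poly_monic.
  apply/rootP; rewrite -eigenvalue_root_char.
  exact: symmetric_eigenvalueP Hs x0 Hx.
have [|P [D [PP /col_eigen MP]]] := @symmetric_spectral _ _ (H + (b + b) *: Q).
  by rewrite linearD linearZ /= Hs Qs.
have HE j : H *m col j P = D 0 j *: col j P - (b + b) *: (Q *m col j P).
  by rewrite -MP mulmxDl -scalemxAl addrK.
have HQE j : H *m (Q *m col j P) = (D 0 j - (b + b)) *: (Q *m col j P).
  rewrite mulmxA HQ -mulmxA HE mulmxBr -!scalemxAr (mulmxA Q Q) QQ.
  by rewrite scalerBl.
have QP j : Q *m col j P = 0 \/ Q *m col j P = col j P.
  have [|Q0] := eqVneq (Q *m col j P) 0; first by left.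
  have [/eqP|P0] := eqVneq (col j P - Q *m col j P) 0.
    by rewrite subr_eq0 => /eqP <-; right.
  (* Otherwise [Q p] and [p - Q p], for [p] the column [j], are eigenvectors of [H] whose
     eigenvalues differ by [b + b], although both lie strictly between [- b] and [b]. *)
  have := bP _ _ Q0 (HQE j).
  have /(bP _ _ P0) : H *m (col j P - Q *m col j P)
                    = D 0 j *: (col j P - Q *m col j P).
    by rewrite mulmxBr HQE HE scalerBl opprB scalerBr addrA subrK.
  rewrite !ltr_norml => /andP[_ Db] /andP[bD _].
  by exfalso; move: Db bD; clear; lra.
(* On columns fixed by [Q] the shift [b + b] is subtracted again to recover the eigenvalue of
   [H]. *)
exists P, (\row_j if Q *m col j P == 0 then D 0 j else D 0 j - (b + b)).
split=> //; apply/col_eigen => j; rewrite mxE.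
have [Q0|Q0] := eqVneq (Q *m col j P) 0.
  by rewrite HE Q0 scaler0 subr0.
by have [/eqP|QE] := QP j; [rewrite (negbTE Q0) | rewrite -[in LHS]QE HQE QE].
Qed.

(** In coordinates [y] of an orthonormal eigenbasis the form is the sum of [D_j y_j^2], with every
    [D_j] at least [m]. *)
Lemma rayleigh_ge (R : rcfType) (n : nat) (H : 'M[R]_n) (m : R) :
  H^T = H -> (forall a, eigenvalue H a -> m <= a) ->
  forall v : 'cV[R]_n, m * (v^T *m v) 0 0 <= (v^T *m (H *m v)) 0 0.
Proof.
move=> Hs mH v; have [P [D [PP HP]]] := symmetric_spectral Hs.
have mD j : m <= D 0 j.
  apply: mH; apply: symmetric_eigenvalueP Hs (orthogonal_col_neq0 j PP) _.
  exact: (col_eigen H P D).1.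
pose y := P^T *m v; have -> : v = P *m y by rewrite mulmxA (mulmx1C PP) mul1mx.
rewrite trmx_mul -!mulmxA (mulmxA P^T P) PP mul1mx.
rewrite (mulmxA H) HP -!mulmxA (mulmxA P^T P) PP mul1mx.
rewrite !dotcE mulr_sumr; apply: ler_sum => i _.
rewrite mul_diag_mx [X in _ <= _ * X]mxE [leRHS]mulrCA.
by rewrite ler_wpM2r// -expr2 sqr_ge0.
Qed.

(** * Directional derivatives and mean values *)

(** Meant for intermediate points supplied by the mean value theorem: [g] is a mere choice, with no
    continuity in [h], and the product is squeezed by [|h|]. *)
Lemma cvg_mul_itv01_0 (R : realType) (g : R -> R) :
  (forall h, 0 < g h < 1) -> ((g h * h) @[h --> 0^'] --> 0)%classic.
Proof.
move=> g01; apply: norm_cvg0.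
apply: (@squeeze_cvgr _ _ _ _ (cst 0) (fun h => `|h|)).
- near=> h; rewrite normr_ge0 normrM /= ler_piMl//.
  by have /andP[g0 g1] := g01 h; rewrite gtr0_norm// ltW.
- exact: cvg_cst.
- rewrite -[X in cvg_to _ (nbhs X)](@normr0 _ R); apply: cvg_norm.
  by apply: cvg_trans (@nbhs_dnbhs _ _) _; exact: cvg_id.
Unshelve. all: by end_near. Qed.

Section directional.
Local Open Scope classical_set_scope.
Variables (R : realType) (V : normedModType R).
Implicit Types (f : V -> R) (x y u v e : V).

Lemma is_derive_line f x v (t : R) : derivable f (x + t *: v) v ->
  is_derive t 1 (fun s : R => f (x + s *: v)) ('D_v f (x + t *: v)).
Proof.
have E : (fun h : R => h^-1 *: (((fun s => f (x + s *: v)) \o shift t) (h *: 1)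
              - f (x + t *: v))) =
         (fun h => h^-1 *: ((f \o shift (x + t *: v)) (h *: v)
              - f (x + t *: v))).
  apply/funext => h /=; congr (_ *: (f _ - _)).
  by rewrite [h *: 1]mulr1 scalerDl addrCA.
by move=> df; split; rewrite /derivable /derive E.
Qed.

(** The segment is parametrized by [0, 1], which treats every sign of [t] at once. *)
Lemma MVT_line f x v (t : R) : (forall y, derivable f y v) ->
  exists2 c : R, 0 < c < 1 &
    f (x + t *: v) - f x = t * 'D_v f (x + (c * t) *: v).
Proof.
move=> df; pose phi s := f (x + (s * t) *: v).
have dphi (s : R) : is_derive s 1 phi (t * 'D_v f (x + (s * t) *: v)).
  have lin : is_derive s (1 : R) (fun s : R => s * t) t.
    have -> : (fun s : R => s * t) = t *: (@id R).
      by apply/funext => r; rewrite mulrC.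
    by apply: is_derive_eq; rewrite [LHS]mulr1.
  rewrite mulrC.
  exact: (@is_derive1_comp R (fun s => f (x + s *: v)) _ s _ t
            (is_derive_line (df _)) lin).
have cphi : {within `[0, 1], continuous phi}.
  apply: continuous_subspaceT => s; apply/differentiable_continuous.
  by apply/derivable1_diffP; have [] := dphi s.
have [c c01] := MVT (@ltr01 R) (fun s _ => dphi s) cphi.
rewrite /phi mul1r mul0r scale0r subr0 mulr1 addr0 => ->.
by exists c => //; rewrite in_itv in c01.
Qed.

(** The increment along [h (u + c e)] is split into a move along [u], handled by the derivative at
    [x], and a move along [e], handled by the mean value theorem and continuity of ['D_e f] at
    [x]. *)
Lemma is_deriveDZ f x u e (du c : R) :
  is_derive x u f du -> (forall y, derivable f y e) ->
  {for x, continuous ('D_e f)} ->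
  is_derive x (u + c *: e) f (du + c * 'D_e f x).
Proof.
move=> [fu fuE] fe cfe.
have /choice[th th01] : forall h : R, exists th : R, 0 < th < 1 /\
    f (x + h *: u + (h * c) *: e) - f (x + h *: u) =
    h * c * 'D_e f (x + h *: u + (th * (h * c)) *: e).
  by move=> h; have [r] := MVT_line (x + h *: u) (h * c) fe; exists r.
pose y h := x + h *: u + (th h * (h * c)) *: e.
have cy : y h @[h --> (0 : R)^'] --> x.
  have thc0 : (th h * (h * c)) @[h --> (0 : R)^'] --> (0 : R).
    rewrite -[X in _ --> X](mul0r c).
    rewrite (_ : (fun h => th h * (h * c)) = (fun h => th h * h * c)); last first.
      by apply/funext => h; exact: mulrA.
    by apply: cvgMr_tmp; apply: cvg_mul_itv01_0 => h; have [] := th01 h.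
  have hc : (h : R) @[h --> (0 : R)^'] --> (0 : R).
    by apply: cvg_trans (@nbhs_dnbhs _ _) _; exact: cvg_id.
  rewrite -[X in _ --> X](addr0 x) -[X in _ --> (x + X)](scale0r u).
  rewrite -[X in _ --> X]addr0 -[X in _ --> (_ + X)](scale0r e).
  apply: cvgD; last exact: cvgZr_tmp.
  by apply: cvgD; [exact: cvg_cst|exact: cvgZr_tmp].
have lim : h^-1 *: ((f \o shift x) (h *: (u + c *: e)) - f x)
    @[h --> (0 : R)^'] --> du + c * 'D_e f x.
  have : h^-1 *: ((f \o shift x) (h *: u) - f x) + c * 'D_e f (y h)
      @[h --> (0 : R)^'] --> du + c * 'D_e f x.
    apply: cvgD; first by rewrite -fuE; exact: fu.
    by apply: cvgMl_tmp; exact: (cvg_comp _ _ cy cfe).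
  apply: cvg_trans; apply: near_eq_cvg; near=> h.
  have h0 : h != 0 by near: h; exact: nbhs_dnbhs_neq.
  have [_] := th01 h; rewrite -/(y h) => E /=.
  have -> : h *: (u + c *: e) + x = x + h *: u + (h * c) *: e.
    by rewrite scalerDr scalerA addrC addrA.
  rewrite [h *: u + x]addrC -(subrK (f (x + h *: u)) (f (_ + _ + _))) E.
  rewrite -[X in _ = _ *: X]addrA [RHS]scalerDr [RHS]addrC.
  congr (_ + _).
  by rewrite [RHS]mulrA mulrA mulVf// mul1r.
by split; [apply/cvg_ex; eexists; exact: lim | exact: cvg_lim lim].
Unshelve. all: by end_near. Qed.

Lemma is_derive_shiftr f (a : V) x v :
  derivable f (x + a) v ->
  is_derive x v (fun y => f (y + a)) ('D_v f (x + a)).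
Proof.
have E : (fun h : R => h^-1 *: (((fun y => f (y + a)) \o shift x) (h *: v)
              - f (x + a))) =
         (fun h => h^-1 *: ((f \o shift (x + a)) (h *: v) - f (x + a))).
  by apply/funext => h /=; rewrite addrA.
by move=> df; split; rewrite /derivable /derive E.
Qed.

(** Two mean value steps: along [u] for [g y = f (y + h v) - f y], then along [v] for ['D_u f]. *)
Lemma second_difference f x u v (h : R) :
  (forall y, derivable f y u) -> (forall y, derivable ('D_u f) y v) ->
  exists c : R * R, (0 < c.1 < 1 /\ 0 < c.2 < 1) /\
    f (x + h *: u + h *: v) - f (x + h *: u) - (f (x + h *: v) - f x) =
    h ^+ 2 * 'D_v ('D_u f) (x + (c.1 * h) *: u + (c.2 * h) *: v).
Proof.
move=> fu fuv; pose g y := f (y + h *: v) - f y.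
have dg y : is_derive y u g ('D_u f (y + h *: v) - 'D_u f y).
  exact: (is_deriveB (is_derive_shiftr (fu _)) (derivableP (fu y))).
have [c1 c1P /= E1] := MVT_line x h (fun y => @ex_derive _ _ _ _ _ _ _ (dg y)).
have [c2 c2P /= E2] := MVT_line (x + (c1 * h) *: u) h fuv.
exists (c1, c2); split => //=.
rewrite -/(g (x + h *: u)) -/(g x) E1 (@derive_val _ _ _ _ _ _ _ (dg _)) E2.
by rewrite expr2 mulrA.
Qed.

(** The second difference is symmetric in [u] and [v]. Divided by [h^2] it equals either mixed
    derivative at a point tending to [x], so continuity identifies the two limits. *)
Lemma derive_swap f x u v :
  (forall y, derivable f y u) -> (forall y, derivable f y v) ->
  (forall y, derivable ('D_u f) y v) -> (forall y, derivable ('D_v f) y u) ->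
  {for x, continuous ('D_v ('D_u f))} -> {for x, continuous ('D_u ('D_v f))} ->
  'D_v ('D_u f) x = 'D_u ('D_v f) x.
Proof.
move=> fu fv fuv fvu cuv cvu.
have /choice[c cP] := fun h => second_difference x h fu fuv.
have /choice[d dP] := fun h => second_difference x h fv fvu.
have limx (g1 g2 : R -> R) (w1 w2 : V) : (forall h, 0 < g1 h < 1) ->
    (forall h, 0 < g2 h < 1) ->
    x + (g1 h * h) *: w1 + (g2 h * h) *: w2 @[h --> (0 : R)^'] --> x.
  move=> /cvg_mul_itv01_0 l1 /cvg_mul_itv01_0 l2.
  rewrite -[X in _ --> X](addr0 x) -[X in _ --> (x + X)](scale0r w1).
  rewrite -[X in _ --> X]addr0 -[X in _ --> (_ + X)](scale0r w2).
  apply: cvgD; last exact: cvgZr_tmp.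
  by apply: cvgD; [exact: cvg_cst|exact: cvgZr_tmp].
pose yc h := x + ((c h).1 * h) *: u + ((c h).2 * h) *: v.
pose yd h := x + ((d h).1 * h) *: v + ((d h).2 * h) *: u.
have lc : 'D_v ('D_u f) (yc h) @[h --> (0 : R)^'] --> 'D_v ('D_u f) x.
  have ly : yc h @[h --> (0 : R)^'] --> x; last exact: cvg_comp ly cuv.
  by apply: (limx (fun h => (c h).1) (fun h => (c h).2)) => h;
    have [[]] := cP h.
have ld : 'D_u ('D_v f) (yd h) @[h --> (0 : R)^'] --> 'D_u ('D_v f) x.
  have ly : yd h @[h --> (0 : R)^'] --> x; last exact: cvg_comp ly cvu.
  by apply: (limx (fun h => (d h).1) (fun h => (d h).2)) => h;
    have [[]] := dP h.
apply: (@cvg_unique R (@Rhausdorff R) _ _ _ _ lc).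
apply: cvg_trans ld; apply: near_eq_cvg; near=> h.
have h0 : h ^+ 2 != 0 by rewrite expf_neq0//; near: h; exact: nbhs_dnbhs_neq.
have [_ Ec] := cP h; have [_ Ed] := dP h.
apply: (mulfI h0); apply: (etrans (esym Ed)); apply: etrans Ec.
rewrite [x + h *: v + h *: u]addrAC -!addrA !opprB.
by congr (_ + _); rewrite addrCA [RHS]addrCA; congr (_ + _); exact: addrC.
Unshelve. all: by end_near. Qed.

End directional.

(** * Gradient and Hessian from continuous partial derivatives *)

Section gradient.
Local Open Scope classical_set_scope.
Variables (R : realType) (d : nat).
Implicit Types (f : 'cV[R]_d -> R) (x u v w : 'cV[R]_d).

Lemma sum_basis_vec v : v = \sum_i v i ord0 *: basis_vec R i.
Proof.
rewrite [LHS]matrix_sum_delta; apply: eq_bigr => i _.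
by rewrite big_ord1.
Qed.

(** The direction [v] is built up one basis vector at a time, each added by [is_deriveDZ]. *)
Lemma is_derive_grad f x v :
  (forall i y, derivable f y (basis_vec R i)) ->
  (forall i, {for x, continuous (pderiv i f)}) ->
  is_derive x v f ((v^T *m grad f x) 0 0).
Proof.
move=> df cf.
have -> : (v^T *m grad f x) 0 0 = \sum_i v i 0 * pderiv i f x.
  by rewrite mxE; apply: eq_bigr => i _; rewrite !mxE.
rewrite [X in is_derive _ X](sum_basis_vec v).
elim: (index_enum _) => [|i s IHs].
  rewrite !big_nil.
  exact: is_derive0.
rewrite !big_cons addrC [X in is_derive _ _ _ X]addrC.
exact: is_deriveDZ IHs (df i) (cf i).
Qed.

Lemma derive_comp_mulmx f (A : 'M[R]_d) x v :
  'D_v (fun y => f (A *m y)) x = 'D_(A *m v) f (A *m x).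
Proof.
rewrite /derive.
suff -> : (fun h => h^-1 *: (((fun y => f (A *m y)) \o shift x) (h *: v)
                             - f (A *m x))) =
  (fun h => h^-1 *: ((f \o shift (A *m x)) (h *: (A *m v)) - f (A *m x))) by [].
by apply/funext => h /=; rewrite mulmxDr -scalemxAr.
Qed.

Variable f : 'cV[R]_d -> R.
Hypothesis f_C2 : C2 f.

Let df i y : derivable f y (basis_vec R i).
Proof. by case: f_C2 => _ /(_ i)[]. Qed.

Let cf i x : {for x, continuous (pderiv i f)}.
Proof. by case: f_C2 => _ /(_ i)[_ []]. Qed.

Let ddf i j y : derivable (pderiv i f) y (basis_vec R j).
Proof. by case: f_C2 => _ /(_ i)[_ [_ /(_ j)[]]]. Qed.

Let cddf i j x : {for x, continuous (pderiv j (pderiv i f))}.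
Proof. by case: f_C2 => _ /(_ i)[_ [_ /(_ j)[]]]. Qed.

Lemma C2_is_derive x v : is_derive x v f ((v^T *m grad f x) 0 0).
Proof. by apply: is_derive_grad => [i y|i]; [exact: df|exact: cf]. Qed.

Lemma C2_derive x v : 'D_v f x = (v^T *m grad f x) 0 0.
Proof. by have [] := C2_is_derive x v. Qed.

(** ['D_u f] is a fixed linear combination of the partial derivatives, and [is_derive_grad] applies
    to each of them. *)
Lemma C2_is_derive2 x u v :
  is_derive x v ('D_u f) ((u^T *m (hessian f x *m v)) 0 0).
Proof.
have -> : 'D_u f = \sum_(i < d) (u i 0 *: pderiv i f).
  apply/funext => y; rewrite C2_derive.
  rewrite fct_sumE mxE; apply: eq_bigr => i _.
  by rewrite !mxE.
have -> : (u^T *m (hessian f x *m v)) 0 0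
   = \sum_i u i 0 *: (v^T *m grad (pderiv i f) x) 0 0.
  rewrite mxE; apply: eq_bigr => i _; rewrite !mxE; congr (_ * _).
  by apply: eq_bigr => j _; rewrite !mxE mulrC.
apply: is_derive_sum => i; apply: is_deriveZ.
apply: is_derive_grad => [j y|j].
  exact: ddf.
exact: cddf.
Qed.

Lemma C2_derive2 x u v :
  'D_v ('D_u f) x = (u^T *m (hessian f x *m v)) 0 0.
Proof. by have [] := C2_is_derive2 x u v. Qed.

Lemma hessian_sym x : (hessian f x)^T = hessian f x.
Proof.
apply/matrixP => i j; rewrite !mxE.
exact: (@derive_swap R _ f x (basis_vec R j) (basis_vec R i)
  (@df j) (@df i) (@ddf j i) (@ddf i j) (@cddf j i x) (@cddf i j x)).
Qed.

End gradient.

(** * Derivatives of the squared norm and of the regularized loss *)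

Lemma sqnormE (R : realType) (d : nat) (w : 'cV[R]_d) :
  sqnorm w = (w^T *m w) 0 0.
Proof. by rewrite dotcE; apply: eq_bigr => i _; rewrite expr2. Qed.

Lemma is_derive_coord (R : realType) (d : nat) (x v : 'cV[R]_d) (i : 'I_d) :
  is_derive x v (fun w : 'cV[R]_d => w i 0) (v i 0).
Proof.
have did : derivable (@id 'cV[R]_d) x v by exact: derivable_id.
split; first by have /derivable_mxP := did; exact.
by have /matrixP/(_ i 0) := derive_mx did; rewrite derive_id mxE => ->.
Qed.

Lemma is_derive_sqnorm (R : realType) (d : nat) (x v : 'cV[R]_d) :
  is_derive x v (@sqnorm R d) (2 * (v^T *m x) 0 0).
Proof.
have -> : @sqnorm R d = \sum_(i < d) (fun w : 'cV[R]_d => w i 0) ^+ 2.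
  by apply/funext => w; rewrite fct_sumE.
rewrite dotcE mulr_sumr; apply: is_derive_sum => i.
apply: (is_derive_eq (is_deriveX 2 (is_derive_coord x v i))).
by rewrite /= expr1 [LHS]mulrC mulrCA.
Qed.

Lemma grad_ell (R : realType) (d : nat) (f : 'cV[R]_d -> R) (gamma : R)
    (w : 'cV[R]_d) : C2 f -> grad (ell f gamma) w = grad f w + (gamma * 2) *: w.
Proof.
move=> fC2; apply/colP => i; rewrite !mxE.
have [/derivableP fd _] := C2_is_derive fC2 w (basis_vec R i).
have sd := is_deriveZ gamma (is_derive_sqnorm w (basis_vec R i)).
rewrite /pderiv (_ : ell f gamma = f + gamma *: @sqnorm R d) //.
rewrite (@derive_val _ _ _ _ _ _ _ (is_deriveD fd sd)); congr (_ + _).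
by rewrite /basis_vec trmx_delta -rowE mxE; exact: mulrA.
Qed.

(** * Consequences of the mirror symmetry *)

Section mirror.
Variables (R : realType) (d k : nat) (f : 'cV[R]_d -> R) (O : 'M[R]_(d, k)).
Hypotheses (fC2 : C2 f) (OO : O^T *m O = 1%:M).
Hypothesis fO :
  forall w : 'cV[R]_d, f w = f ((1%:M - 2%:R *: (O *m O^T)) *m w).

Let Q := O *m O^T.
Let A : 'M[R]_d := 1%:M - 2%:R *: Q.

Let Qs : Q^T = Q. Proof. by rewrite /Q trmx_mul trmxK. Qed.

Let OQ : O^T *m Q = O^T. Proof. by rewrite mulmxA OO mul1mx. Qed.

Let QQ : Q *m Q = Q. Proof. by rewrite -[LHS]mulmxA OQ. Qed.

Let As : A^T = A. Proof. by rewrite linearB linearZ /= trmx1 Qs. Qed.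

Let AA : A *m A = 1%:M.
Proof.
rewrite mulmxBl mul1mx mulmxBr mulmx1 -scalemxAl -scalemxAr QQ scalerA.
rewrite -addrA -opprD addrA -scalerDl -scalerBl.
by have -> : 2 + 2 - 2 * 2 = 0 :> R by [ring|]; rewrite scale0r subr0.
Qed.

Let A_fix (w : 'cV[R]_d) : O^T *m w = 0 -> A *m w = w.
Proof.
by move=> w0; rewrite mulmxBl mul1mx -scalemxAl -mulmxA w0 mulmx0 scaler0 subr0.
Qed.

Lemma mirror_derive (x v : 'cV[R]_d) : 'D_v f x = 'D_(A *m v) f (A *m x).
Proof.
by rewrite -derive_comp_mulmx; congr ('D_v _ x); apply/funext.
Qed.

(** Since [A] fixes [w], it fixes the gradient there; as [O^T A = - O^T], the vector [O^T grad f w]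
    equals its own opposite. *)
Lemma mirror_grad (w : 'cV[R]_d) : O^T *m w = 0 -> O^T *m grad f w = 0.
Proof.
move=> w0; have gA : grad f w = A *m grad f w.
  apply: dotc_inj => u.
  rewrite -(C2_derive fC2 w u) mirror_derive (C2_derive fC2 _ _) (A_fix w0).
  by rewrite trmx_mul As mulmxA.
have : O^T *m (A *m grad f w) = - (O^T *m grad f w).
  rewrite mulmxA mulmxBr mulmx1 -scalemxAr OQ -[X in X - _]scale1r -scalerBl.
  by rewrite (_ : 1 - 2 = -1 :> R) ?scaleN1r ?mulNmx//; ring.
rewrite -gA => /eqP; rewrite -addr_eq0 -mulr2n -scaler_nat scaler_eq0.
by rewrite pnatr_eq0 => /eqP.
Qed.

Lemma mirror_hessian (w : 'cV[R]_d) : O^T *m w = 0 ->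
  hessian f w *m Q = Q *m hessian f w.
Proof.
move=> w0; set H := hessian f w.
have HA : H = A *m H *m A.
  apply/matrixP => i j.
  have : forall v : 'cV[R]_d, H *m v = A *m H *m A *m v.
    move=> v; apply: dotc_inj => u.
    rewrite -(C2_derive2 fC2 w u v).
    (* The first-order symmetry holds at every point, so it can be differentiated once more. *)
    have -> : 'D_u f = fun x => 'D_(A *m u) f (A *m x).
      by apply/funext => x; exact: mirror_derive.
    rewrite (derive_comp_mulmx ('D_(A *m u) f)).
    rewrite (C2_derive2 fC2 _ _ _) (A_fix w0).
    by rewrite trmx_mul As !mulmxA.
  move=> /(_ (delta_mx j 0)); rewrite -!colE => /colP/(_ i).
  by rewrite [LHS]mxE [RHS]mxE.
have : H *m A = A *m H by rewrite {1}HA -mulmxA AA mulmx1.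
rewrite mulmxBl mulmxBr mul1mx mulmx1 -scalemxAl -scalemxAr.
(* With [A = 1 - 2 Q], commutation with [A] reads [2 H Q = 2 Q H]. *)
move=> /(congr1 (fun M => H - M)); rewrite !subKr.
by apply: scalerI; rewrite pnatr_eq0.
Qed.

(** Pythagoras for [w = (1 - Q) w + Q w], where [|Q w| = |O^T w|]. *)
Lemma sqnorm_projection (w : 'cV[R]_d) :
  sqnorm w = sqnorm ((1%:M - Q) *m w) + sqnorm (O^T *m w).
Proof.
have QQc : (1%:M - Q) *m (1%:M - Q) = 1%:M - Q.
  by rewrite mulmxBl mul1mx mulmxBr mulmx1 QQ subrr subr0.
rewrite !sqnormE !trmx_mul trmxK [(1%:M - Q)^T]linearB /= trmx1 Qs -!mulmxA.
rewrite (mulmxA (1%:M - Q) (1%:M - Q)) QQc (mulmxA O O^T) -/Q.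
by rewrite mulmxBl mul1mx mulmxBr [X in X + _]mxE [X in _ + X + _]mxE subrK.
Qed.

(* Along the segment from (1 - Q) w to w the derivative of f starts at 0 by
   symmetry and its own derivative is at least lmin |Q w|^2. *)
Lemma mirror_projection_le (lmin : R) (w : 'cV[R]_d) :
  (forall x a, eigenvalue (hessian f x) a -> lmin <= a) ->
  f ((1%:M - Q) *m w) - f w <= `|lmin| * sqnorm (O^T *m w).
Proof.
move=> fmin; set m := (1%:M - Q) *m w; pose q := Q *m w.
have qq : (q^T *m q) 0 0 = sqnorm (O^T *m w).
  rewrite sqnormE /q [(Q *m w)^T]trmx_mul [(O^T *m w)^T]trmx_mul Qs trmxK.
  by rewrite -mulmxA (mulmxA Q Q) QQ /Q -!mulmxA.
have mq : w = m + 1 *: q by rewrite scale1r /m mulmxBl mul1mx subrK.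
have m0 : O^T *m m = 0.
  by rewrite /m mulmxA mulmxBr mulmx1 OQ subrr mul0mx.
have df v y : derivable f y v.
  by apply: ex_derive; exact: C2_is_derive.
have ddf u v y : derivable ('D_u f) y v.
  by apply: ex_derive; exact: C2_is_derive2.
have [c /andP[c0 c1]] := MVT_line m 1 (df q).
rewrite -mq mul1r mulr1 => fE.
have [e _] := MVT_line m c (ddf q q).
have -> : 'D_q f m = 0.
  rewrite (C2_derive fC2 m q).
  by rewrite /q trmx_mul Qs /Q -!mulmxA mirror_grad// !mulmx0 mxE.
rewrite subr0 -fE (C2_derive2 fC2 _ q q) => E.
have := rayleigh_ge (hessian_sym fC2 (m + (e * c) *: q)) (fmin _) q.
rewrite qq -opprB E; set X := (_ *m _) 0 0 => HX.
have n0 : 0 <= sqnorm (O^T *m w) by rewrite sqnormE dotc_ge0.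
have Ln0 : 0 <= `|lmin| * sqnorm (O^T *m w) by rewrite mulr_ge0.
have XL : 0 <= X + `|lmin| * sqnorm (O^T *m w).
  rewrite -lerBlDr sub0r -mulNr (le_trans _ HX)// ler_wpM2r//.
  by rewrite lerNl -normrN ler_norm.
rewrite -subr_ge0.
(* Here [f w - f m = c X] with [c] in (0, 1), and the gap is a convex combination of two nonnegative
   quantities. *)
have -> : `|lmin| * sqnorm (O^T *m w) - - (c * X) =
    c * (X + `|lmin| * sqnorm (O^T *m w))
    + (1 - c) * (`|lmin| * sqnorm (O^T *m w)) by ring.
by rewrite addr_ge0// mulr_ge0// ?subr_ge0 ltW.
Qed.

End mirror.

(** * Symmetry, spectral splitting and collapse under weight decay *)

Theorem theorem1 (R : realType) (d k : nat) (l0 : 'cV[R]_d -> R)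
  (O : 'M[R]_(d, k)) :
  C2 l0 ->
  O^T *m O = 1%:M ->
  (forall w : 'cV[R]_d, l0 w = l0 ((1%:M - 2%:R *: (O *m O^T)) *m w)) ->
  (* 1. *)
  (forall (gamma : R) (w : 'cV[R]_d),
      O^T *m w = 0 -> O^T *m grad (ell l0 gamma) w = 0)
  /\
  (* 2. *)
  (forall w : 'cV[R]_d, O *m O^T *m w = 0 ->
     let H := hessian l0 w in
     (forall v : 'cV[R]_d, O^T *m v = 0 -> O^T *m (H *m v) = 0) /\
     (forall v : 'cV[R]_d, (exists u, v = O *m O^T *m u) ->
        exists u', H *m v = O *m O^T *m u') /\
     (exists (P : 'M[R]_d) (D : 'rV[R]_d) (S : {set 'I_d}),
        P^T *m P = 1%:M /\
        H *m P = P *m diag_mx D /\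
        (forall j, j \in S -> O^T *m col j P = 0) /\
        (forall j, j \notin S -> exists u, col j P = O *m O^T *m u) /\
        (forall v : 'cV[R]_d, O^T *m v = 0 ->
           exists c : 'cV[R]_d, (forall j, j \notin S -> c j ord0 = 0) /\
                                v = P *m c) /\
        (forall v : 'cV[R]_d, (exists u, v = O *m O^T *m u) ->
           exists c : 'cV[R]_d, (forall j, j \in S -> c j ord0 = 0) /\
                                v = P *m c)))
  /\
  (* 3. *)
  (forall w : 'cV[R]_d, O^T *m w != 0 ->
     exists gamma0 : R, forall gamma : R, gamma0 < gamma ->
       ell l0 gamma ((1%:M - O *m O^T) *m w) < ell l0 gamma w)
  /\
  (* 4. *)
  (forall lmin : R,
     (forall (w : 'cV[R]_d) (lambda : R),
        eigenvalue (hessian l0 w) lambda -> lmin <= lambda) ->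
     exists gamma1 : R, forall gamma : R, gamma1 < gamma ->
       forall w : 'cV[R]_d,
         (forall v : 'cV[R]_d, ell l0 gamma w <= ell l0 gamma v) ->
         O^T *m w = 0).
Proof.
move=> fC2 OO fO.
have OQ : O^T *m (O *m O^T) = O^T by rewrite mulmxA OO mul1mx.
have Qs : (O *m O^T)^T = O *m O^T by rewrite trmx_mul trmxK.
have colE_dot (P : 'M[R]_d) (v : 'cV[R]_d) j :
    (P^T *m v) j 0 = ((col j P)^T *m v) 0 0.
  by rewrite !mxE; apply: eq_bigr => i _; rewrite !mxE.
have Ow0 (w : 'cV[R]_d) : O *m O^T *m w = 0 -> O^T *m w = 0.
  by move=> w0; rewrite -OQ -mulmxA w0 mulmx0.
split=> [gamma w w0|].
  by rewrite grad_ell// mulmxDr -scalemxAr w0 scaler0 addr0 mirror_grad.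
split=> [w /Ow0 w0 H|].
  have HQ := mirror_hessian fC2 OO fO w0.
  rewrite -/H in HQ.
  split=> [v v0|].
    by rewrite -OQ -mulmxA (mulmxA _ H) -HQ -!mulmxA v0 !mulmx0.
  split=> [_ [u ->]|].
    by exists (H *m u); rewrite !(mulmxA _ _ u) -HQ mulmxA.
  have QQ : O *m O^T *m (O *m O^T) = O *m O^T by rewrite -[LHS]mulmxA OQ.
  have [P [D [PP HP PQ]]] :=
    symmetric_projection_spectral (hessian_sym fC2 w) Qs QQ HQ.
  (* [S] collects the columns killed by [Q]; all others are fixed by [Q], hence lie in its image. *)
  pose S := [set j | O *m O^T *m col j P == 0].
  have inS j : j \in S -> O^T *m col j P = 0 by rewrite inE => /eqP/Ow0.
  have ninS j : j \notin S -> col j P = O *m O^T *m col j P.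
    by rewrite inE; have [->|] := PQ j; rewrite ?eqxx.
  have PPT v : v = P *m (P^T *m v) by rewrite mulmxA (mulmx1C PP) mul1mx.
  exists P, D, S; do 2 split=> //.
  split; first by move=> j /inS.
  split; first by move=> j /ninS ?; exists (col j P).
  split=> [v v0|_ [u ->]].
    (* The coordinates of [v] are its inner products with the columns of [P]; those outside [S] lie
       in the image of [Q], orthogonal to the kernel of [O^T]. *)
    exists (P^T *m v); split=> // j jS; rewrite colE_dot.
    by rewrite (ninS _ jS) trmx_mul Qs -!mulmxA v0 !mulmx0 mxE.
  exists (P^T *m (O *m O^T *m u)); split=> // j jS; rewrite colE_dot.
  rewrite !mulmxA -[X in X *m _ *m _]trmxK trmx_mul trmxK.
  by rewrite inS// trmx0 !mul0mx mxE.
split=> [w w0|lmin fmin].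
  have n0 : 0 < sqnorm (O^T *m w).
    by rewrite sqnormE lt0r dotc_eq0 w0 dotc_ge0.
  (* The threshold is the increase of [l0] under projection divided by the decrease of the squared
     norm. *)
  exists ((l0 ((1%:M - O *m O^T) *m w) - l0 w) / sqnorm (O^T *m w)) => gamma.
  rewrite ltr_pdivrMr// ltrBlDl => lt_gamma.
  rewrite /ell (sqnorm_projection OO w) mulrDr.
  by rewrite [gamma * sqnorm (_ *m w) + _]addrC addrA ltrD2r.
(* Comparing a minimizer with its projection gives [gamma |O^T w|^2 <= |lmin| |O^T w|^2], impossible
   for [gamma > |lmin|] unless [O^T w = 0]. *)
exists `|lmin| => gamma lt_gamma w w_min; apply/eqP/negPn/negP => w0.
have n0 : 0 < sqnorm (O^T *m w).
  by rewrite sqnormE lt0r dotc_eq0 w0 dotc_ge0.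
have := w_min ((1%:M - O *m O^T) *m w).
rewrite /ell (sqnorm_projection OO w) mulrDr addrCA [leRHS]addrC lerD2l.
rewrite -lerBrDl => /le_trans/(_ (mirror_projection_le fC2 OO fO w fmin)).
by rewrite ler_pM2r// leNgt lt_gamma.
Qed.
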